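(* Let $\Delta$ be an odd operator of second order (order $\leq2$) in a commutative associative algebra $A$ with a unit. The condition $\operatorname{ord}\Delta^2\leq2$ is equivalent to the Jacobi identity for the bracket generated by $\Delta$.
   Context: The algebra $A$ is $\mathbb Z_2$-graded (over a field of characteristic zero) and supercommutative; a tilde denotes parity. An operator $\Delta$ has order $\leq k$, $\operatorname{ord}\Delta\le k$, if all $(k+1)$-fold commutators $[\ldots[[\Delta,a_1],a_2],\ldots,a_{k+1}]$ with multiplications by elements $a_i\in A$ vanish. The (odd symmetric) bracket generated by an odd operator $\Delta$ of order $\leq 2$ is $$\{a,b\}=\Delta(ab)-(\Delta a)\,b-(-1)^{\tilde a}a\,(\Delta b)+\Delta(1)\,ab.$$ Its Jacobi identity is $$(-1)^{\tilde a\tilde c}\{\{a,b\},c\}+(-1)^{\tilde c\tilde b}\{\{c,a\},b\}+(-1)^{\tilde b\tilde a}\{\{b,c\},a\}=0\quad\text{for all }a,b,c\in A.$$ *)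

(* Defs.v *)
From mathcomp Require Import all_boot all_order all_algebra.

Set Implicit Arguments.
Unset Strict Implicit.
Unset Printing Implicit Defensive.

Import GRing.Theory.
Local Open Scope ring_scope.

(* Parities are booleans ([false] even, [true] odd), so that parities add by
   [(+)] and a Koszul sign (-1)^(pq) is [(-1) ^+ (p && q)].  The homogeneous
   components are arbitrary, possibly infinite-dimensional, subspaces. *)
Record supergrading (k : fieldType) (A : algType k) := Supergrading {
  homog : bool -> A -> Prop;
  homog0 : forall p, homog p 0;
  homogD : forall p a b, homog p a -> homog p b -> homog p (a + b);
  homogZ : forall p (c : k) a, homog p a -> homog p (c *: a);
  homog_sum : forall a, exists a0 a1,
    [/\ homog false a0, homog true a1 & a = a0 + a1];
  homog_direct : forall a, homog false a -> homog true a -> a = 0;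
  homog1 : homog false 1;
  homogM : forall p q a b, homog p a -> homog q b -> homog (p (+) q) (a * b)
}.

Section SuperAlgebra.

Variables (k : fieldType) (A : algType k) (G : supergrading A).

Definition supercommutative : Prop :=
  forall p q (a b : A), homog G p a -> homog G q b ->
    a * b = (-1) ^+ (p && q) * (b * a).

Definition op_parity (p : bool) (D : A -> A) : Prop :=
  forall q a, homog G q a -> homog G (p (+) q) (D a).

(* The supercommutator [S, T] of operators S, T of parities p, q. *)
Definition supercomm (p q : bool) (S T : A -> A) : A -> A :=
  fun x => S (T x) - (-1) ^+ (p && q) *: T (S x).

(* [...[[D, a_1], a_2], ..., a_n] for D of parity p and
   s = [:: (parity of a_1, a_1); ...; (parity of a_n, a_n)], each a_i standing
   for the operator of multiplication by a_i. *)
Fixpoint iter_comm (p : bool) (D : A -> A) (s : seq (bool * A)) : A -> A :=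
  if s is (q, a) :: s' then
    iter_comm (p (+) q) (supercomm p q D (fun x => a * x)) s'
  else D.

(* ord D <= n, for D of parity p; by multilinearity of the iterated
   commutator it is enough to let the a_i be homogeneous. *)
Definition ord_le (p : bool) (n : nat) (D : A -> A) : Prop :=
  forall s : n.+1.-tuple (bool * A),
    (forall i, homog G (tnth s i).1 (tnth s i).2) ->
    forall x, iter_comm p D s x = 0.

(* {a, b} for a of parity p; the sign does not involve the parity of b. *)
Definition bracket (D : A -> A) (p : bool) (a b : A) : A :=
  D (a * b) - D a * b - (-1) ^+ p * (a * D b) + D 1 * (a * b).

(* D being odd, {a, b} has parity p + q + 1 (see bracket_homog); this is the
   parity of the first argument of the outer bracket. *)
Definition nested_bracket (D : A -> A) (p q : bool) (a b c : A) : A :=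
  bracket D (~~ (p (+) q)) (bracket D p a b) c.

Definition jacobi (D : A -> A) : Prop :=
  forall (pa pb pc : bool) (a b c : A),
    homog G pa a -> homog G pb b -> homog G pc c ->
    (-1) ^+ (pa && pc) * nested_bracket D pa pb a b c
    + (-1) ^+ (pc && pb) * nested_bracket D pc pa c a b
    + (-1) ^+ (pb && pa) * nested_bracket D pb pc b c a = 0.

Lemma homog_sign p (e : nat) a : homog G p a -> homog G p ((-1) ^+ e * a).
Proof.
move=> ha; rewrite -signr_odd; case: odd; rewrite ?expr0 ?mul1r //.
by rewrite expr1 mulN1r -scaleN1r; apply: homogZ.
Qed.

Lemma homogB p a b : homog G p a -> homog G p b -> homog G p (a - b).
Proof. by move=> ha hb; apply: homogD => //; rewrite -scaleN1r; apply: homogZ. Qed.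

Lemma supercomm_parity p q S T :
  op_parity p S -> op_parity q T -> op_parity (p (+) q) (supercomm p q S T).
Proof.
move=> hS hT r a ha; apply: homogB.
  by rewrite -addbA; apply/hS/hT.
by apply: homogZ; rewrite (addbC p) -addbA; apply/hT/hS.
Qed.

Lemma bracket_homog D p q a b : op_parity true D ->
  homog G p a -> homog G q b -> homog G (~~ (p (+) q)) (bracket D p a b).
Proof.
move=> hD ha hb; rewrite -addTb.
apply: homogD; first apply: homogB; first apply: homogB.
- exact/hD/homogM.
- by rewrite addbA; apply: homogM => //; apply: hD.
- by apply: homog_sign; rewrite addbCA; apply: homogM => //; apply: hD.
- by apply: homogM; [exact: (hD _ _ (homog1 G)) | exact: homogM].
Qed.

End SuperAlgebra.

(* Main.v *)
Require Import Defs.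
From mathcomp Require Import all_boot all_order all_algebra.

Set Implicit Arguments.
Unset Strict Implicit.
Unset Printing Implicit Defensive.

Import GRing.Theory.
Local Open Scope ring_scope.

(** Write D for the operator, [S, T] for supercommutators, D_a for [D, a], D_ab
    for [[D, a], b], and so on, where a stands for the multiplication by a.

    Linear operators form a Lie superalgebra, so commuting with a multiplication
    is a superderivation of the supercommutator (supercomm_jacobi).  Since D is
    odd, D^2 behaves as half of [D, D], and the Leibniz rule on [D, D] becomes
    [D^2, a] = [D, D_a] (supercomm_square).  Two more applications of the rule
    give, up to Koszul signs,

      [[[D^2, a], b], c] = [D, D_abc] + [D_c, D_ab] + [D_b, D_ac] + [D_bc, D_a].

    As ord D <= 2, the first term vanishes and D_ab commutes with all
    multiplications, so it is the multiplication by its value at 1, which is the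
    bracket {a, b} (comm2_bracket).  Hence [D_c, D_ab] = [[D, c], {a, b}] is in
    turn the multiplication by {c, {a, b}} (comm1_comm2).  By the symmetry of the
    bracket (bracket_sym), the whole sum is the multiplication by plus or minus
    the left-hand side of the Jacobi identity (comm3_square).  A multiplication
    operator is zero exactly when its value at 1 is, hence the equivalence. *)

(** * Operators under the supercommutator *)

Section Operators.

Variables (k : fieldType) (A : algType k).
Implicit Types (S T U : A -> A) (p q r : bool).

Lemma linear_mul (a : A) : linear (fun x : A => a * x).
Proof. by move=> c x y; rewrite mulrDr scalerAr. Qed.

Lemma linear_addZ S c x y : linear S -> S (c *: x + y) = c *: S x + S y.
Proof. by move=> hS; apply: hS. Qed.

Lemma linear_subZ S c x y : linear S -> S (x - c *: y) = S x - c *: S y.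
Proof. by move=> hS; rewrite -scaleNr addrC linear_addZ // scaleNr addrC. Qed.

Lemma supercomm_linear p q S T :
  linear S -> linear T -> linear (supercomm p q S T).
Proof.
move=> hS hT c x y; rewrite /supercomm.
rewrite !(linear_addZ _ _ _ hS, linear_addZ _ _ _ hT).
by rewrite scalerDr opprD addrACA scalerBr !scalerA mulrC.
Qed.

Lemma eq_supercomm p q S S' T T' :
  S =1 S' -> T =1 T' -> supercomm p q S T =1 supercomm p q S' T'.
Proof. by move=> hS hT x; rewrite /supercomm hS !hT hS. Qed.

Lemma supercomm_addl p q S S' c U x : linear U ->
  supercomm p q (fun y => S y + c *: S' y) U x
  = supercomm p q S U x + c *: supercomm p q S' U x.
Proof.
move=> hU; rewrite /supercomm.
rewrite [S x + _]addrC (linear_addZ _ _ _ hU) [_ + U (S x)]addrC.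
by rewrite scalerDr opprD addrACA scalerBr !scalerA mulrC.
Qed.

Lemma supercomm_anti p q S T x :
  supercomm q p T S x = - (-1) ^+ (p && q) *: supercomm p q S T x.
Proof.
rewrite /supercomm scaleNr scalerBr scalerA opprB andbC.
by rewrite -expr2 sqrr_sign scale1r.
Qed.

(** The super Jacobi identity of operators, in Leibniz form: the supercommutator
    with U acts as a derivation on that of S and T, the sign being the cost of
    moving U past T. *)
Lemma supercomm_jacobi p q r S T U x : linear S -> linear T -> linear U ->
  supercomm (p (+) q) r (supercomm p q S T) U x
  = supercomm p (q (+) r) S (supercomm q r T U) x
    + (-1) ^+ (q && r) *: supercomm (p (+) r) q (supercomm p r S U) T x.
Proof.
move=> hS hT hU; rewrite /supercomm.
rewrite !(linear_subZ _ _ _ hS, linear_subZ _ _ _ hT, linear_subZ _ _ _ hU).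
rewrite (andbC (p (+) q)) (andbC (p (+) r)) !andb_addr !signr_addb.
rewrite ![_ && p]andbC (andbC r q).
(* The identity is polynomial in the three pairwise signs; of these only the one
   of (q, r) occurs squared. *)
have := sqrr_sign k (q && r); rewrite expr2.
move: ((-1) ^+ (p && q)) ((-1) ^+ (p && r)) ((-1) ^+ (q && r)) => u v w ww.
rewrite !(scalerBr, scalerA, opprB) (mulrCA w u w) ww mulr1.
rewrite -(mulrA u v w) (mulrC u (v * w)) (mulrC w v).
(* On the right the products S U T and T U S occur twice, with opposite signs;
   the permutation pairs them off in the last two places. *)
rewrite [RHS](AC ((2*2)*(2*2)) (((1*8)*(3*6))*((5*2)*(7*4)))) /=.
by rewrite !subrr !addr0.
Qed.

End Operators.

(** * Second-order odd operators *)

Section SecondOrder.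

Variables (k : fieldType) (A : algType k) (G : supergrading A).
Hypothesis hA : supercommutative G.
Variable D : {linear A -> A}.
Hypothesis hodd : op_parity G true D.

Local Notation comm1 p a := (supercomm true p D (fun x => a * x)).
Local Notation comm2 p q a b :=
  (supercomm (~~ p) q (comm1 p a) (fun x => b * x)).

Lemma linear_D : linear D.
Proof. exact: linearP. Qed.

Lemma linear_comm1 p a : linear (comm1 p a).
Proof. by apply: supercomm_linear; [exact: linear_D | exact: linear_mul]. Qed.

(** The first Leibniz step for D^2.  Going through [D, D] would count everything
    twice and call for a division by 2; here the two terms D a D cancel because
    the sign of (1, p + 1) is opposite to that of p. *)
Lemma supercomm_square p a x :
  supercomm false p (fun y => D (D y)) (fun y => a * y) x
  = supercomm true (~~ p) D (comm1 p a) x.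
Proof.
rewrite /supercomm /= (linear_subZ _ _ _ linear_D).
rewrite signrN scaleNr opprK scale1r scalerBr scalerA -expr2 sqrr_sign.
by rewrite scale1r addrA subrK.
Qed.

Lemma scale_sign (b : bool) (x : A) : (-1) ^+ b * x = (-1) ^+ b *: x.
Proof. by rewrite mulr_sign scaler_sign. Qed.

(** The bracket inherits the symmetry of the product: D being odd, exchanging
    the two Leibniz terms costs the same sign as exchanging a and b. *)
Lemma bracket_sym p q a b : homog G p a -> homog G q b ->
  bracket D p a b = (-1) ^+ (p && q) *: bracket D q b a.
Proof.
move=> ha hb; rewrite /bracket.
rewrite (hA ha hb) (hA (hodd ha) hb) (hA ha (hodd hb)) !addTb.
rewrite !scale_sign linearZ /= !(scalerDr, scalerN) -!scalerAr.
rewrite !scalerA -!signr_addb.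
have -> : p (+) p && ~~ q = p && q by case: (p) (q) => [] [].
have -> : (p && q) (+) q = ~~ p && q by case: (p) (q) => [] [].
by congr (_ + _); rewrite addrAC.
Qed.

(** The bracket is the principal symbol of D, polarized: the double commutator
    evaluated at the unit.  The term in D 1 is what is left of D applied to the
    unit once both multiplications have been moved to its left. *)
Lemma comm2_at1 p q a b : homog G p a -> homog G q b ->
  comm2 p q a b 1 = bracket D p a b.
Proof.
move=> ha hb; rewrite /supercomm !mulr1 andTb mulrBr -scalerAr mulrA.
rewrite (hA hb (hodd ha)) (hA (homogM hb ha) (hodd (homog1 G))) (hA hb ha).
rewrite /bracket !scale_sign -!scalerAr scalerBr !scalerA -!signr_addb.
have -> : (~~ p && q) (+) (q && (true (+) p)) = false by case: (p) (q) => [] [].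
have -> : (((~~ p && q) (+) p) (+) ((q (+) p) && (true (+) false))) (+) (q && p)
  = false by case: (p) (q) => [] [].
by rewrite !scale1r opprB [LHS](AC (2*2) (1*4*2*3)).
Qed.

Hypothesis hord : ord_le G true 2 D.

Lemma comm3_eq0 p q r a b c x :
  homog G p a -> homog G q b -> homog G r c ->
  supercomm (~~ p (+) q) r (comm2 p q a b) (fun y => c * y) x = 0.
Proof.
move=> ha hb hc; have := hord (s := [tuple (p, a); (q, b); (r, c)]).
by apply; case=> [[|[|[|//]]]] i.
Qed.

(** The vanishing of the third commutator with y, read at 1, says that the value
    of the double commutator at y is determined by its value at 1. *)
Lemma comm2_bracket p q a b x : homog G p a -> homog G q b ->
  comm2 p q a b x = bracket D p a b * x.
Proof.
move=> ha hb.
have hom r y : homog G r y -> comm2 p q a b y = bracket D p a b * y.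
  move=> hy; have /eqP := comm3_eq0 1 ha hb hy.
  rewrite {1}/supercomm subr_eq0 mulr1 comm2_at1 // => /eqP ->.
  by rewrite (hA (bracket_homog hodd ha hb) hy) scale_sign addNb.
(* The order condition only concerns homogeneous elements. *)
have [y [z [hy hz ->]]] := homog_sum G x.
have lin : linear (comm2 p q a b).
  by apply: supercomm_linear; [exact: linear_comm1 | exact: linear_mul].
have := linear_addZ 1 y z lin; rewrite !scale1r mulrDr => ->.
by congr (_ + _); [exact: hom hy | exact: hom hz].
Qed.

Lemma nested_bracket_sym p q a b c : homog G p a -> homog G q b ->
  nested_bracket D p q a b c = (-1) ^+ (p && q) *: nested_bracket D q p b a c.
Proof.
move=> ha hb; rewrite /nested_bracket (bracket_sym ha hb) addbC.
rewrite /bracket -!scalerAl !linearZ /= !(scalerDr, scalerN, scalerA).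
by rewrite -!scalerAl -!scalerAr.
Qed.

(** The inner double commutator is the multiplication by {a, b}, so the outer
    supercommutator is again a double commutator of D, with c and {a, b}; the
    sign comes from turning {c, {a, b}} into {{a, b}, c}. *)
Lemma comm1_comm2 p q r a b c x :
  homog G p a -> homog G q b -> homog G r c ->
  supercomm (~~ r) (~~ p (+) q) (comm1 r c) (comm2 p q a b) x
  = (-1) ^+ ((~~ p (+) q) && r) *: (nested_bracket D p q a b c * x).
Proof.
move=> ha hb hc.
have hB : homog G (~~ p (+) q) (bracket D p a b).
  by rewrite addNb; apply: bracket_homog.
rewrite (eq_supercomm _ _ (frefl _) (fun y => comm2_bracket y ha hb)).
by rewrite comm2_bracket // (bracket_sym hc hB) andbC addNb -scalerAl.
Qed.

(** The three terms that survive the Leibniz expansion are the three cyclic terms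
    of the Jacobi identity, each with the same overall sign. *)
Lemma comm3_square pa pb pc a b c x :
  homog G pa a -> homog G pb b -> homog G pc c ->
  supercomm (pa (+) pb) pc (supercomm pa pb (supercomm false pa
      (fun y => D (D y)) (fun y => a * y)) (fun y => b * y)) (fun y => c * y) x
  = (-1) ^+ (pa && pc) *:
    (((-1) ^+ (pa && pc) * nested_bracket D pa pb a b c
     + (-1) ^+ (pc && pb) * nested_bracket D pc pa c a b
     + (-1) ^+ (pb && pa) * nested_bracket D pb pc b c a) * x).
Proof.
move=> ha hb hc.
have hD := linear_D; have h1 := linear_comm1; have hm := linear_mul.
have step1 := supercomm_square pa a.
have step2 : supercomm pa pb (supercomm false pa
      (fun y => D (D y)) (fun y => a * y)) (fun y => b * y) =1
    fun y => supercomm true (~~ pa (+) pb) D (comm2 pa pb a b) y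
      + (-1) ^+ (~~ pa && pb) *:
        supercomm (~~ pb) (~~ pa) (comm1 pb b) (comm1 pa a) y.
  move=> y; rewrite (eq_supercomm _ _ step1 (frefl _)).
  by rewrite -{1}[pa]negbK -addTb supercomm_jacobi.
rewrite (eq_supercomm _ _ step2 (frefl _)) supercomm_addl //.
(* The parity of the operator, split as required by each Leibniz step. *)
have e1 : pa (+) pb = true (+) (~~ pa (+) pb) by rewrite addTb addNb negbK.
have e2 : pa (+) pb = ~~ pb (+) ~~ pa by rewrite addNb addbN negbK addbC.
have hab : linear (comm2 pa pb a b) by apply: supercomm_linear.
rewrite {1}e1 (supercomm_jacobi true (~~ pa (+) pb) pc x hD hab (hm _ _ c)).
rewrite e2 (supercomm_jacobi (~~ pb) (~~ pa) pc x (h1 _ b) (h1 _ a) (hm _ _ c)).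
have -> : supercomm true ((~~ pa (+) pb) (+) pc) D
    (supercomm (~~ pa (+) pb) pc (comm2 pa pb a b) (fun y => c * y)) x = 0.
  rewrite (eq_supercomm _ _ (frefl _) (fun y => comm3_eq0 y ha hb hc)).
  by rewrite /supercomm !raddf0 addr0.
(* The last term has D_bc on the left, contrary to the other two. *)
rewrite [X in _ + _ *: (_ + _ *: X)]supercomm_anti addTb.
rewrite !comm1_comm2 // (nested_bracket_sym b ha hc).
move: (nested_bracket D pa pb a b c) (nested_bracket D pc pa c a b)
  (nested_bracket D pb pc b c a) => X Y Z.
rewrite !scale_sign !mulrDl -!scalerAl add0r !scalerDr !scalerA addrA.
by case: (pa) (pb) (pc) => [] [] [];
  rewrite /= ?expr0 ?expr1 ?(mulN1r, mulrN1, mul1r, mulr1, opprK, mulNr, mulrN).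
Qed.

End SecondOrder.

Theorem proposition3p2 (k : fieldType) (hk : [pchar k] =i pred0)
    (A : algType k) (G : supergrading A) (hA : supercommutative G)
    (Delta : {linear A -> A}) (hodd : op_parity G true Delta)
    (hord : ord_le G true 2 Delta) :
  ord_le G false 2 (fun x => Delta (Delta x)) <-> jacobi G Delta.
Proof.
split=> [h pa pb pc a b c ha hb hc
  | hJ [[|[pa a] [|[pb b] [|[pc c] [|]]]] //= hs] h x].
  have := comm3_square hA hodd hord 1 ha hb hc.
  have /= -> := h [tuple (pa, a); (pb, b); (pc, c)] _ 1.
    by rewrite mulr1 => /esym/eqP; rewrite scaler_eq0 signr_eq0 => /eqP.
  by case=> [[|[|[|//]]]] i.
have ha : homog G pa a := h ord0.
have hb : homog G pb b := h 1.
have hc : homog G pc c := h (Ordinal (isT : 2 < 3)%N).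
have /= -> := comm3_square hA hodd hord x ha hb hc.
by rewrite (hJ _ _ _ _ _ _ ha hb hc) mul0r scaler0.
Qed.
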